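(* Let $p\in\mathbb{N}=\{0,1,2,\dots\}$ and let $q$ be a critical offspring distribution ($\mu=1$) that admits a moment of order $p$. Then, for every $s\in[0,1]$, every $n\in\mathbb{N}$ and every $\Lambda_n\in\mathscr{F}_n$, $$\lim_{m\to+\infty}\frac{\mathbb{E}\left[H_p(Z_{m+n})s^{Z_{m+n}}\mathbf{1}_{\Lambda_n}\right]}{\mathbb{E}\left[H_p(Z_{m+n})s^{Z_{m+n}}\right]}=\begin{cases}\mathbb{E}[\mathbf{1}_{\Lambda_n}] & \text{if }p=0,\\ \mathbb{E}[Z_n\mathbf{1}_{\Lambda_n}] & \text{if }p\ge 1.\end{cases}$$
   Context: $q=(q_n)_{n\in\mathbb{N}}$ is a probability distribution on the nonnegative integers with mean $\mu=\sum_n nq_n$. $(Z_n)_{n\ge 0}$ is the Galton-Watson process with offspring distribution $q$ started from $Z_0=1$, and $(\mathscr{F}_n)_{n\ge 0}$ is its natural filtration. The polynomials $H_p$ are $H_0(x)=1$ and $H_p(x)=\frac{1}{p!}\prod_{k=0}^{p-1}(x-k)$ for $p\ge 1$. Convention: $0^0=1$.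
   Formalization: The cases where the denominator vanishes for every m, so the ratio is 0/0, are excluded: s = 0 with p ≥ 1, and, when q is the Dirac mass at 1 (q_1 = 1), p ≥ 2 or s = 0. *)

(* Defs.v *)
From mathcomp Require Import all_boot all_order all_algebra.
From mathcomp Require Import all_classical all_reals all_analysis.

Set Implicit Arguments.
Unset Strict Implicit.
Unset Printing Implicit Defensive.

Import Order.TTheory GRing.Theory Num.Theory.
Import numFieldNormedType.Exports.

Local Open Scope classical_set_scope.
Local Open Scope ring_scope.

Definition is_offspring_distribution (R : realType) (q : R^nat) : Prop :=
  (forall k, 0 <= q k) /\ (\sum_(0 <= k <oo) (q k)%:E = 1)%E.

Definition offspring_mean (R : realType) (q : R^nat) : \bar R :=
  (\sum_(0 <= k <oo) (k%:R * q k)%:E)%E.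

Definition critical (R : realType) (q : R^nat) : Prop :=
  offspring_mean q = 1%E.

Definition has_moment (R : realType) (p : nat) (q : R^nat) : Prop :=
  (\sum_(0 <= k <oo) (k%:R ^+ p * q k)%:E < +oo)%E.

(* All subsets of nat are measurable, so B ranges over all families of events. *)
Definition mutually_independent (d : measure_display) (T : measurableType d)
    (R : realType) (P : probability T R) (I : choiceType)
    (X : I -> {RV P >-> nat}) : Prop :=
  forall (J : seq I) (B : I -> set nat), uniq J ->
    P (\bigcap_(i in [set` J]) (X i @^-1` B i)) =
    (\prod_(i <- J) P (X i @^-1` B i))%E.

(* xi k i is the number of children of the i-th individual of generation k. *)
Definition is_galton_watson (d : measure_display) (T : measurableType d)
    (R : realType) (P : probability T R) (q : R^nat)
    (Z : nat -> {RV P >-> nat}) : Prop :=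
  exists xi : nat -> nat -> {RV P >-> nat},
    [/\ mutually_independent (fun ki : nat * nat => xi ki.1 ki.2),
        forall k i j, P (xi k i @^-1` [set j]) = (q j)%:E,
        forall w, Z 0%N w = 1%N &
        forall k w, Z k.+1 w = (\sum_(i < Z k w) xi k i w)%N].

Definition natural_filtration (d : measure_display) (T : measurableType d)
    (R : realType) (P : probability T R) (Z : nat -> {RV P >-> nat})
    (n : nat) : set (set T) :=
  g_sigma_preimage (fun k : 'I_n.+1 => (Z k : T -> nat)).

Definition hilbert_poly (R : realType) (p : nat) : {poly R} :=
  (p`!%:R)^-1 *: \prod_(k < p) ('X - k%:R%:P).

(* Main.v *)
Require Import Defs.
From mathcomp Require Import all_boot all_order all_algebra.
From mathcomp Require Import all_classical all_reals all_analysis.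
From mathcomp Require Import measurable_realfun.
From mathcomp Require Import lra ring.

Set Implicit Arguments.
Unset Strict Implicit.
Unset Printing Implicit Defensive.

Import Order.TTheory GRing.Theory Num.Theory.
Import numFieldNormedType.Exports.

Local Open Scope classical_set_scope.
Local Open Scope ring_scope.

(** Mark [p] individuals of generation [m + n] and weight the population by
    [s] to the power of its size. The weighted number of markings is
    [A (m + n) p], where [A m j], the expectation of [C(Z m, j) * s ^ Z m], is the
    [j]-th coefficient in [t] of the [m]-th iterate of the offspring generating
    function at [s + s t]. By the Markov and branching properties, given that
    generation [n] has size [k], this expectation becomes the coefficient of
    [t ^ p] in the [k]-th power of the series with coefficients [A m]. The
    numerator is therefore the sum over [k] of [P (L /\ Z n = k)] times that
    coefficient ([expectation_slices], [branching_evolution_cpow]), and the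
    denominator is the same sum with the sure event in place of [L]. Dividing
    both by [A m p], the mark-carrying weight of one family, it is enough to find
    the limit of each quotient ([ratio_cvg_all]).

    For [p = 0] the coefficient is [A m 0 ^ k], and [A m 0] tends to 1 because a
    critical population with a genuine branching dies out
    ([iter_comp_gf_cvg1]). For [p > 0] the coefficient contains the [k] terms in
    which a single family carries all the marks, each of them equal to
    [A m 0 ^ (k - 1) * A m p]; after division they contribute [k] in the limit.
    The marks have no reason to be spread over several families: the products
    [A m i * A m j] with [i, j > 0] are negligible with respect to
    [A m (i + j)] ([moment_product_negligible]). Indeed such a product is a double
    sum over two population sizes, the larger of which can carry the whole power
    while the smaller one only contributes the survival probability
    ([moment_product_le]), and the moment of order [i + j] of the weighted
    population is comparable with [A m (i + j)] because [A m (i + j) / A m 1] does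
    not decrease with [m] ([moment_ratio_mono]). The remaining terms are then at
    most a vanishing multiple of [k ^ p] ([cpow_le_eps]), which is summable as
    generation [n] has a moment of order [p].

    When [q 1 = 1] the population stays at 1 almost surely, [A m] does not depend
    on [m], and the quotients are constant.

    So the two quotients tend to the expectations of [1_L] and 1 when [p = 0], and
    of [Z n * 1_L] and [Z n] when [p > 0]; the second one is 1 in both cases. *)

(** * Series of nonnegative reals *)

(** The sum is an extended real, so that exchanging sums needs no
    summability. *)
Definition nsum (R : realType) (x : nat -> R) : \bar R :=
  (\sum_(0 <= k <oo) (x k)%:E)%E.

Lemma eq_nsum (R : realType) (x y : nat -> R) : x =1 y -> nsum x = nsum y.
Proof. by move=> xy; apply: eq_eseriesr => k _; rewrite xy. Qed.

Lemma nsum_ge0 (R : realType) (x : nat -> R) :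
  (forall k, 0 <= x k) -> (0 <= nsum x)%E.
Proof. by move=> x0; apply: nneseries_ge0 => k _ _; rewrite lee_fin. Qed.

Lemma le_nsum (R : realType) (x y : nat -> R) :
  (forall k, 0 <= x k) -> (forall k, x k <= y k) -> (nsum x <= nsum y)%E.
Proof.
by move=> x0 xy; apply: lee_nneseries => k *; rewrite lee_fin.
Qed.

Lemma nsumZ (R : realType) (c : R) (x : nat -> R) :
  (forall k, 0 <= x k) -> nsum (fun k => c * x k) = (c%:E * nsum x)%E.
Proof.
move=> x0; rewrite /nsum -nneseriesZl; last by move=> *; rewrite lee_fin.
by apply: eq_eseriesr => k _; rewrite EFinM.
Qed.

Lemma nsumD (R : realType) (x y : nat -> R) :
  (forall k, 0 <= x k) -> (forall k, 0 <= y k) ->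
  nsum (fun k => x k + y k) = (nsum x + nsum y)%E.
Proof.
by move=> x0 y0; rewrite -nneseriesD// => k *; rewrite lee_fin.
Qed.

Lemma nsum_sum (R : realType) n (x : nat -> nat -> R) :
  (forall i k, 0 <= x i k) ->
  nsum (fun k => \sum_(i < n) x i k) = (\sum_(i < n) nsum (x i))%E.
Proof.
move=> x0; rewrite /nsum -nneseries_sum//; try by move=> *; rewrite lee_fin.
by apply: eq_eseriesr => k _; rewrite sumEFin.
Qed.

Lemma nsum_fin (R : realType) (x : nat -> R) :
  (forall k, 0 <= x k) -> (nsum x < +oo)%E ->
  nsum x = (fine (nsum x))%:E /\ 0 <= fine (nsum x).
Proof.
move=> x0 xoo; have xge0 := nsum_ge0 x0.
split; last exact: fine_ge0.
by rewrite fineK// ge0_fin_numE.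
Qed.

Lemma nsum_interchange (R : realType) (x : nat -> nat -> R) :
  (forall i k, 0 <= x i k) ->
  (\sum_(0 <= i <oo) nsum (x i))%E = (\sum_(0 <= k <oo) nsum (x^~ k))%E.
Proof. by move=> x0; apply: nneseries_interchange => i k; rewrite lee_fin. Qed.

Lemma nsum_ge_partial (R : realType) (x : nat -> R) n :
  (forall k, 0 <= x k) -> ((\sum_(0 <= k < n) x k)%:E <= nsum x)%E.
Proof.
move=> x0; rewrite -sumEFin; apply: nneseries_lim_ge => k _ _.
by rewrite lee_fin.
Qed.

Lemma nsum_ge_term (R : realType) (x : nat -> R) n :
  (forall k, 0 <= x k) -> ((x n)%:E <= nsum x)%E.
Proof.
move=> x0; apply: le_trans (nsum_ge_partial n.+1 x0).
by rewrite lee_fin big_nat_recr//= lerDr sumr_ge0.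
Qed.

Lemma nsum_cvg (R : realType) (x : nat -> R) (S : R) :
  (forall k, 0 <= x k) -> nsum x = S%:E ->
  (fun n => \sum_(0 <= k < n) x k) @ \oo --> S.
Proof.
move=> x0 xS.
suff /fine_cvg : (fun n => (\sum_(0 <= k < n) x k)%:E) @ \oo --> S%:E by [].
rewrite -xS /nsum.
have : cvgn (fun n => \sum_(0 <= k < n) (x k)%:E)%E.
  by apply: is_cvg_nneseries => k _ _; rewrite lee_fin.
by under eq_fun do rewrite sumEFin.
Qed.

Lemma nsum_delta (R : realType) (x : nat -> R) n :
  (forall k, 0 <= x k) -> (forall k, k != n -> x k = 0) -> nsum x = (x n)%:E.
Proof.
move=> x0 xn; rewrite /nsum (@nneseriesD1 _ _ n)//; last first.
  by move=> k _; rewrite lee_fin.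
by rewrite eseries0 ?adde0// => k _ /= kn; rewrite xn.
Qed.

(** Both sides sum [x i * y l * F (i + l)] over all pairs [(i, l)]; on the left
    the pairs are grouped by the value of [i + l]. *)
Lemma nsum_cauchy (R : realType) (x y F : nat -> R) :
  (forall k, 0 <= x k) -> (forall k, 0 <= y k) -> (forall k, 0 <= F k) ->
  nsum (fun j => (\sum_(i < j.+1) x i * y (j - i)%N) * F j) =
  (\sum_(0 <= i <oo) nsum (fun l => x i * y l * F (i + l)%N)%R)%E.
Proof.
move=> x0 y0 F0.
pose a i j := if (i <= j)%N then x i * y (j - i)%N * F j else 0.
have a0 i j : 0 <= a i j by rewrite /a; case: ifP => // _; rewrite !mulr_ge0.
transitivity (\sum_(0 <= i <oo) nsum (a i))%E; last first.
  apply: eq_eseriesr => i _.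
  rewrite /nsum (nneseries_split 0 i); last by move=> *; rewrite lee_fin.
  rewrite add0n big1_seq ?add0e; last first.
    by move=> j /andP[_]; rewrite mem_index_iota /a => /andP[_ ji]; rewrite leqNgt ji.
  rewrite -nneseries_addn; last by move=> *; rewrite lee_fin.
  by apply: eq_eseriesr => l _; rewrite /a leq_addl addnK addnC.
rewrite nsum_interchange//; apply: eq_eseriesr => j _.
rewrite /nsum (nneseries_split 0 j.+1); last by move=> *; rewrite lee_fin.
rewrite add0n [X in (_ + X)%E]eseries0 ?adde0; last first.
  by move=> i ji _; rewrite /a leqNgt ji.
rewrite sumEFin big_mkord mulr_suml; congr EFin.
by apply: eq_bigr => i _; rewrite /a -ltnS ltn_ord.
Qed.

Lemma nsum_mul (R : realType) (x y : nat -> R) (a b : R) :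
  (forall k, 0 <= x k) -> (forall k, 0 <= y k) ->
  nsum x = a%:E -> nsum y = b%:E ->
  (\sum_(0 <= i <oo) nsum (fun l => x i * y l)%R)%E = (a * b)%:E.
Proof.
move=> x0 y0 xa yb.
transitivity (nsum (fun i => b * x i)).
  by apply: eq_eseriesr => i _; rewrite nsumZ// yb -EFinM mulrC.
by rewrite nsumZ// xa -EFinM mulrC.
Qed.

(** Only a lower bound has to be proved: a finite partial sum already comes
    within [eps] of [S], and on finitely many terms [t m ^+ e k] tends to 1. *)
Lemma nsum_cvg_powers (R : realType) (x : nat -> R) (e : nat -> nat)
    (S : R) (t y : nat -> R) :
  (forall k, 0 <= x k) -> nsum x = S%:E ->
  (forall m, 0 <= t m <= 1) -> t @ \oo --> (1 : R) ->
  (forall m, nsum (fun k => x k * t m ^+ e k) = (y m)%:E) ->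
  y @ \oo --> S.
Proof.
move=> x0 xS t01 t1 xy.
have yS m : y m <= S.
  rewrite -lee_fin -xS -xy; apply: le_nsum => k.
    by rewrite mulr_ge0// exprn_ge0//; case/andP: (t01 m).
  by rewrite ler_piMr// exprn_ile1//; case/andP: (t01 m).
apply/cvgrPdist_lt => eps eps0.
have e2 : 0 < eps / 2 by rewrite divr_gt0.
have /cvgrPdist_lt/(_ _ e2)[N _ /(_ N)/= /(_ (leqnn _)) HN] := nsum_cvg x0 xS.
have cN : (fun m => \sum_(0 <= k < N) x k * t m ^+ e k) @ \oo -->
    \sum_(0 <= k < N) x k.
  rewrite [X in _ --> X](_ : _ = \sum_(0 <= k < N) x k * 1 ^+ e k); last first.
    by apply: eq_bigr => k _; rewrite expr1n mulr1.
  apply: cvg_big => [|k _]; first exact: add_continuous.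
  apply: cvgM; first exact: cvg_cst.
  exact: (cvg_comp t (fun u : R => u ^+ e k) t1 (@exprn_continuous _ (e k) 1)).
move/cvgrPdist_lt : cN => /(_ _ e2); apply: filterS => m Hm.
have : \sum_(0 <= k < N) x k * t m ^+ e k <= y m.
  rewrite -lee_fin -xy; apply: nsum_ge_partial => k.
  by rewrite mulr_ge0// exprn_ge0//; case/andP: (t01 m).
have := yS m; move: HN Hm; rewrite !ltr_norml => /andP[? ?] /andP[? ?] ? ?.
apply/andP; split; lra.
Qed.

(** * Convolution powers *)

(** [cpow a k j] is the coefficient of [t ^ j] in the [k]-th power of the formal
    power series with coefficients [a]. *)
Fixpoint cpow (R : pzSemiRingType) (a : nat -> R) (k j : nat) : R :=
  if k is k'.+1 then \sum_(i < j.+1) a i * cpow a k' (j - i)%N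
  else (j == 0%N)%:R.

Lemma cpowS (R : pzSemiRingType) (a : nat -> R) k j :
  cpow a k.+1 j = \sum_(i < j.+1) a i * cpow a k (j - i)%N.
Proof. by []. Qed.

Lemma cpow_poly (R : nzSemiRingType) (a : nat -> R) N k j : (j < N)%N ->
  cpow a k j = ((\poly_(i < N) a i) ^+ k)`_j.
Proof.
elim: k j => [|k IH] j jN; first by rewrite expr0 coef1.
rewrite exprS coefM cpowS; apply: eq_bigr => i _.
rewrite coef_poly (leq_ltn_trans _ jN) ?leq_ord// IH//.
by rewrite (leq_ltn_trans _ jN)// leq_subr.
Qed.

Lemma cpowD (R : nzSemiRingType) (a : nat -> R) k l j :
  cpow a (k + l) j = \sum_(i < j.+1) cpow a k i * cpow a l (j - i)%N.
Proof.
rewrite (cpow_poly _ _ (ltnSn j)) exprD coefM; apply: eq_bigr => i _.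
by rewrite !(@cpow_poly _ _ j.+1)// ltnS leq_subr.
Qed.

Lemma cpow0 (R : pzSemiRingType) (a : nat -> R) k : cpow a k 0 = a 0%N ^+ k.
Proof.
elim: k => [|k IH]; first by rewrite expr0.
by rewrite cpowS big_ord1 IH exprS.
Qed.

Lemma cpow1 (R : pzSemiRingType) (a : nat -> R) j : cpow a 1 j = a j.
Proof.
rewrite cpowS big_ord_recr/= subnn mulr1 big1 ?add0r// => i _.
by rewrite subn_eq0 leqNgt ltn_ord mulr0.
Qed.

(** The first factor carries nothing, a part of [j], or the whole of it; the main
    contributions come from the two extreme cases. *)
Lemma cpowS_split (R : pzSemiRingType) (a : nat -> R) k j : (0 < j)%N ->
  cpow a k.+1 j = a 0%N * cpow a k j
    + \sum_(1 <= i < j) a i * cpow a k (j - i)%N + a j * a 0%N ^+ k.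
Proof.
move=> j0; rewrite cpowS -(big_mkord xpredT (fun i => a i * cpow a k (j - i)%N)).
by rewrite big_nat_recr//= big_ltn// subn0 subnn cpow0.
Qed.

Lemma cpow_at1 (R : comNzRingType) (a : nat -> R) k :
  cpow a k 1 = k%:R * a 0%N ^+ k.-1 * a 1%N.
Proof.
elim: k => [|k IH]; first by rewrite !mul0r.
rewrite cpowS_split// big_geq// addr0 IH; case: k {IH} => [|k] /=.
  by rewrite !mul0r mulr0 add0r !mul1r mulr1.
by rewrite -[k.+2]addn1 natrD exprS; ring.
Qed.

(** The family with generating function [c + c t], whose [k]-th power is given
    by the binomial theorem. *)
Definition affine_seq (R : pzSemiRingType) (c : R) (j : nat) : R :=
  if (j <= 1)%N then c else 0.

Lemma cpow_affine (R : comPzSemiRingType) (c : R) k j :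
  cpow (affine_seq c) k j = c ^+ k * 'C(k, j)%:R.
Proof.
elim: k j => [|k IH] j; first by rewrite expr0 mul1r; case: j.
case: j => [|j]; first by rewrite cpow0 bin0 mulr1.
rewrite cpowS 2!big_ord_recl/= big1 ?addr0; last by move=> i _; rewrite mul0r.
by rewrite subn0 subSS subn0 !IH binS natrD mulrDr exprS !mulrA.
Qed.

Lemma cpow_ge0 (R : numDomainType) (a : nat -> R) k j :
  (forall i, 0 <= a i) -> 0 <= cpow a k j.
Proof.
move=> a0; elim: k j => [|k IH] j; first by rewrite ler0n.
by rewrite cpowS sumr_ge0// => i _; rewrite mulr_ge0.
Qed.

(** The [k] ways of concentrating [j] on a single factor. *)
Lemma cpow_ge (R : numDomainType) (a : nat -> R) k j :
  (forall i, 0 <= a i) -> (0 < j)%N ->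
  k%:R * a 0%N ^+ k.-1 * a j <= cpow a k j.
Proof.
move=> a0 j0; elim: k => [|k IH]; first by rewrite !mul0r cpow_ge0.
rewrite cpowS_split//.
apply: (@le_trans _ _ (a 0%N * cpow a k j + a j * a 0%N ^+ k)); last first.
  rewrite lerD2r lerDl; apply: sumr_ge0 => i _.
  by rewrite mulr_ge0// cpow_ge0.
rewrite /= -natr1 mulrDl mul1r mulrDl [_ ^+ k * _]mulrC lerD2r.
case: k IH => [|k] IH; first by rewrite !mul0r mulr_ge0.
apply: le_trans (ler_wpM2l (a0 0%N) IH).
by rewrite /= exprS !mulrA [_ * a 0%N]mulrC.
Qed.

(** In the binomial expansion of [(k + 1) ^ j] all the inner coefficients are at
    least 2. *)
Lemma leq_sum_exp j k : (0 < j)%N ->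
  (\sum_(1 <= i < j) 2 * k ^ (j - i) + k ^ j + 1 <= k.+1 ^ j)%N.
Proof.
case: j => // j _; have powE : (k.+1 ^ j.+1 =
    \sum_(0 <= i < j.+2) 'C(j.+1, i) * (k ^ (j.+1 - i) * 1 ^ i))%N.
  by rewrite big_mkord -[k.+1]addn1 expnDn.
rewrite powE [leqRHS]big_nat_recr//= [X in (_ <= X + _)%N]big_ltn//.
rewrite subn0 subnn bin0 binn !mul1n !exp1n !muln1.
rewrite leq_add2r addnC leq_add2l.
rewrite big_nat [leqRHS]big_nat; apply: leq_sum => i /andP[i0 ij].
rewrite exp1n muln1 leq_mul2r; apply/orP; right.
case: i i0 ij => // i _ ij; rewrite binS.
by rewrite (@leq_add 1 1)// bin_gt0// ltnW.
Qed.

(** There are at most [k ^ j] ways to distribute [j] over [k] factors; at most [j]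
    factors receive something, and they contribute at most [M] each, while the
    others contribute at most 1. *)
Lemma cpow_le (R : numDomainType) (a : nat -> R) (M : R) k j :
  (forall i, 0 <= a i) -> a 0%N <= 1 -> 1 <= M ->
  (forall i, (i <= j)%N -> a i <= M) ->
  cpow a k j <= (M * k%:R) ^+ j.
Proof.
move=> a0 a01 M1; elim: k j => [|k IH] j aM.
  by rewrite mulr0 expr0n.
have M0 : 0 <= M by rewrite (le_trans ler01).
case: j aM => [|j] aM; first by rewrite cpow0 expr0 exprn_ile1.
rewrite cpowS_split//.
have c0 i : 0 <= cpow a k i by rewrite cpow_ge0.
have H1 : a 0%N * cpow a k j.+1 <= (M * k%:R) ^+ j.+1.
  by rewrite (le_trans _ (IH _ aM))// ler_piMl.
have H2 : a j.+1 * a 0%N ^+ k <= M ^+ j.+1.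
  apply: (@le_trans _ _ (M ^+ 1)); last by rewrite ler_weXn2l.
  by rewrite expr1 (le_trans _ (aM _ (leqnn _)))// ler_piMr// exprn_ile1.
have H3 i : (1 <= i < j.+1)%N ->
    a i * cpow a k (j.+1 - i)%N <= M ^+ j.+1 * (2 * k ^ (j.+1 - i))%N%:R.
  move=> /andP[i1 ij].
  apply: (@le_trans _ _ (M ^+ i * (M * k%:R) ^+ (j.+1 - i))).
    apply: ler_pM => //.
      by rewrite (le_trans (aM _ (ltnW ij)))// -[leLHS]expr1 ler_weXn2l.
    by apply: IH => l lj; apply: aM; rewrite (leq_trans lj)// leq_subr.
  rewrite exprMn mulrA -exprD subnKC ?(ltnW ij)// natrM natrX.
  rewrite ler_wpM2l ?exprn_ge0// ler_peMl ?exprn_ge0//.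
  by rewrite (ler_nat _ 1).
apply: le_trans (lerD (lerD H1 (ler_sum_nat H3)) H2) _.
rewrite -mulr_sumr exprMn -mulrDr -[X in _ + X]mulr1 -mulrDr exprMn.
rewrite ler_wpM2l ?exprn_ge0//.
have := leq_sum_exp k (ltn0Sn j).
by rewrite -(ler_nat R) !natrD natr_sum !natrX [X in X + _]addrC.
Qed.

(** If splitting a charge into two parts costs a factor [eps], the
    concentrated configurations dominate the others, of which there are at most
    [k ^ j]. *)
Lemma cpow_le_eps (R : realDomainType) (a : nat -> R) (eps : R) p :
  (forall i, 0 <= a i) -> a 0%N <= 1 -> 0 <= eps <= 1 ->
  (forall i j, (0 < i)%N -> (0 < j)%N -> (i + j <= p)%N ->
    a i * a j <= eps * a (i + j)%N) ->
  forall k j, (0 < j <= p)%N -> cpow a k j <= a j * (k%:R + eps * k%:R ^+ j).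
Proof.
move=> a0 a01 /andP[e0 e1] H; elim=> [|k IH] j /andP[j0 jp].
  by rewrite expr0n /= !gtn_eqF// mulr0 addr0 mulr0.
have c0 i : 0 <= cpow a k i by rewrite cpow_ge0.
rewrite cpowS_split//.
have H1 : a 0%N * cpow a k j <= a j * (k%:R + eps * k%:R ^+ j).
  by rewrite (le_trans _ (IH _ _)) ?j0// ler_piMl.
have H2 : a j * a 0%N ^+ k <= a j by rewrite ler_piMr// exprn_ile1.
have H3 i : (1 <= i < j)%N ->
    a i * cpow a k (j - i)%N <= a j * (eps * (2 * k ^ (j - i))%N%:R).
  move=> /andP[i1 ij].
  have ji0 : (0 < j - i)%N by rewrite subn_gt0.
  have jip : (j - i <= p)%N by rewrite (leq_trans (leq_subr _ _)).
  apply: le_trans (ler_wpM2l (a0 i) (IH _ _)) _; first by rewrite ji0.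
  have Hij : a i * a (j - i)%N <= eps * a j.
    by rewrite -{2}(subnKC (ltnW ij)) H// subnKC// ltnW.
  apply: (@le_trans _ _ (eps * a j * (k%:R + eps * k%:R ^+ (j - i)))).
    rewrite mulrA ler_wpM2r// addr_ge0// mulr_ge0// exprn_ge0.
  rewrite [eps * a j]mulrC -mulrA ler_wpM2l// ler_wpM2l//.
  rewrite mul2n -addnn natrD natrX lerD//.
    by rewrite -natrX ler_nat -[leqLHS]expn1; case: (k) => // k'; rewrite leq_pexp2l.
  by rewrite ler_piMl// exprn_ge0.
apply: le_trans (lerD (lerD H1 (ler_sum_nat H3)) H2) _.
rewrite -!mulr_sumr -mulrDr -[X in _ + X]mulr1 -mulrDr ler_wpM2l//.
have := leq_sum_exp k j0.
rewrite -(ler_nat R) !natrD natr_sum !natrX => Hj.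
have := ler_wpM2l e0 Hj; rewrite -natr1 !mulrDr mulr1; lra.
Qed.

(** * Iterated generating functions *)

(** For [k < r] one factor [k] is kept and the others are bounded by [r]; for
    [r <= k] each factor [(k - i) / (r - i)] of the binomial coefficient is at
    least [k / r]. *)
Lemma leq_exp_bin k r : (0 < r)%N -> (k ^ r <= r ^ r * (k + 'C(k, r)))%N.
Proof.
move=> r0; have [kr|rk] := ltnP k r.
  rewrite mulnDr (leq_trans _ (leq_addr _ _))//.
  case: r r0 kr => // r _ kr; rewrite expnS mulnC leq_mul//.
  rewrite expnS (leq_trans _ (leq_pmull _ _))//.
  by case: r kr => // r kr; rewrite leq_exp2r// ltnW.
rewrite mulnDr (leq_trans _ (leq_addl _ _))//.
have powE n : (n ^ r = \prod_(i < r) n)%N by rewrite prod_nat_const card_ord.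
rewrite -(leq_pmul2r (fact_gt0 r)) -mulnA bin_ffact -[in leqLHS]ffactnn.
rewrite !ffact_prod !powE -!big_split/=; apply: leq_prod => i _.
rewrite !mulnBr; apply: leq_sub; first by rewrite mulnC.
by rewrite leq_mul2r rk orbT.
Qed.

(** The coefficients of the composition of the generating function of [q] with
    the series with coefficients [b]; [fine] is harmless for the coefficients
    that are finite. *)
Definition comp_gf (R : realType) (q b : nat -> R) (j : nat) : R :=
  fine (nsum (fun k => q k * cpow b k j)).

(** Composition with the series [b] turns the [k]-th power of the series [q]
    into the [k]-th power of their composition. Probabilistically this is the
    branching property: the descendants of [k] individuals form [k] independent
    families. *)
Lemma nsum_cpow_comp (R : realType) (q b c : nat -> R) p :
  (forall k, 0 <= q k) -> (forall j, 0 <= b j) ->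
  (forall j, (j <= p)%N -> nsum (fun k => q k * cpow b k j) = (c j)%:E) ->
  forall k j, (j <= p)%N ->
    nsum (fun l => cpow q k l * cpow b l j) = (cpow c k j)%:E.
Proof.
move=> q0 b0 qbc; elim=> [|k IH] j jp.
  rewrite (@nsum_delta _ _ 0); first by rewrite mul1r.
    by move=> l; rewrite mulr_ge0 ?cpow_ge0//=.
  by move=> l l0; rewrite /= (negPf l0) mul0r.
rewrite (nsum_cauchy q0 (fun l => cpow_ge0 k l q0) (fun l => cpow_ge0 l j b0)).
pose f t i l := q i * cpow b i t * (cpow q k l * cpow b l (j - t)%N).
have f0 t i l : 0 <= f t i l by rewrite !mulr_ge0 ?cpow_ge0.
transitivity (\sum_(0 <= i <oo) \sum_(t < j.+1) nsum (f t i))%E.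
  apply: eq_eseriesr => i _; rewrite -(@nsum_sum _ _ (fun t => f t i))//.
  apply: eq_nsum => l; rewrite cpowD mulr_sumr; apply: eq_bigr => t _; rewrite /f; ring.
rewrite nneseries_sum; last by move=> t i _; exact: nsum_ge0.
rewrite cpowS -sumEFin; apply: eq_bigr => t _; apply: nsum_mul.
- by move=> i; rewrite mulr_ge0 ?cpow_ge0.
- by move=> i; rewrite mulr_ge0 ?cpow_ge0.
- by apply: qbc; rewrite (leq_trans _ jp)// -ltnS.
- by apply: IH; rewrite (leq_trans _ jp)// leq_subr.
Qed.

Section CriticalIteration.
Context (R : realType) (q : R^nat) (p : nat).
Context (q_dist : is_offspring_distribution q) (q_crit : critical q)
  (q_mom : has_moment p q).

Lemma offspring_ge0 k : 0 <= q k. Proof. by case: q_dist. Qed.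
Local Hint Resolve offspring_ge0 : core.

Lemma nsum_offspring : nsum q = 1%E. Proof. by case: q_dist. Qed.

Lemma nsum_offspring_mean : nsum (fun k => k%:R * q k) = 1%E.
Proof. exact: q_crit. Qed.

Lemma nsum_offspring_moment j : (j <= p)%N ->
  (nsum (fun k => k%:R ^+ j * q k)%R < +oo)%E.
Proof.
move=> jp; apply: (@le_lt_trans _ _ (nsum (fun k => q k + k%:R ^+ p * q k))).
  apply: le_nsum => k; first by rewrite mulr_ge0// exprn_ge0.
  case: k => [|k].
    have [->|j0] := posnP j; first by rewrite mul1r lerDl mulr_ge0// exprn_ge0.
    by rewrite expr0n gtn_eqF// mul0r addr_ge0// mulr_ge0// exprn_ge0.
  rewrite ler_wpDl// ler_wpM2r// ler_weXn2l// (ler_nat _ 1)//.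
rewrite nsumD//; last by move=> k; rewrite mulr_ge0// exprn_ge0.
by rewrite nsum_offspring lte_add_pinfty// ?ltry.
Qed.

(** The generating function of [q] converges on the unit interval, which has to
    contain the constant term of the series substituted in it. *)
Definition admissible (b : nat -> R) : Prop := (forall j, 0 <= b j) /\ b 0%N <= 1.

(** The coefficient of order [j] of a [k]-th power grows at most like [k ^ j], and
    [q] has a moment of that order. *)
Lemma nsum_comp_gf b j : admissible b -> (j <= p)%N ->
  nsum (fun k => q k * cpow b k j) = (comp_gf q b j)%:E.
Proof.
move=> [b0 b1] jp.
have qb0 k : 0 <= q k * cpow b k j by rewrite mulr_ge0 ?cpow_ge0.
pose M := 1 + \sum_(i < j.+1) b i.
have M1 : 1 <= M by rewrite lerDl sumr_ge0.
suff /(nsum_fin qb0)[] : (nsum (fun k => q k * cpow b k j)%R < +oo)%E by [].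
apply: (@le_lt_trans _ _ (nsum (fun k => M ^+ j * (k%:R ^+ j * q k)))).
  apply: le_nsum => // k; rewrite mulrC mulrA -exprMn ler_wpM2r//.
  apply: cpow_le => // i ij; rewrite /M -ltnS in ij *.
  rewrite (bigD1 (Ordinal ij))//= addrCA lerDl addr_ge0//.
  by rewrite sumr_ge0.
rewrite nsumZ; last by move=> k; rewrite mulr_ge0// exprn_ge0.
have := nsum_offspring_moment jp.
have : (0 <= nsum (fun k => k%:R ^+ j * q k)%R)%E.
  by apply: nsum_ge0 => k; rewrite mulr_ge0// exprn_ge0.
by case: (nsum _) => // r _ _; rewrite -EFinM ltry.
Qed.

Lemma comp_gf_admissible b : admissible b -> admissible (comp_gf q b).
Proof.
move=> adb; have [b0 b1] := adb; split => [j|].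
  by apply/fine_ge0/nsum_ge0 => k; rewrite mulr_ge0 ?cpow_ge0.
rewrite -lee_fin -nsum_comp_gf// -nsum_offspring; apply: le_nsum => k.
  by rewrite mulr_ge0 ?cpow_ge0.
by rewrite cpow0 ler_piMr// exprn_ile1.
Qed.

Lemma iter_comp_gf_admissible m b :
  admissible b -> admissible (iter m (comp_gf q) b).
Proof. by move=> adb; elim: m => //= m; exact: comp_gf_admissible. Qed.

Lemma affine_seq_admissible s : 0 <= s <= 1 -> admissible (affine_seq s).
Proof.
by move=> /andP[s0 s1]; split=> // j; rewrite /affine_seq; case: ifP.
Qed.

(** One step replaces each individual by an independent number of children. The
    masses need not add up to 1: [u m k] may be the probability that generation
    [m] has size [k] and that some past event occurs. *)
Definition branching_evolution (u : nat -> nat -> R) : Prop :=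
  (forall m k, 0 <= u m k) /\
  (forall m j, nsum (fun k => u m k * cpow q k j) = (u m.+1 j)%:E).

(** Averaging powers of [b] after [m] generations is averaging powers of the
    [m]-th iterate at the start. *)
Lemma branching_evolution_cpow u m b j :
  branching_evolution u -> admissible b -> (j <= p)%N ->
  nsum (fun k => u m k * cpow b k j) =
  nsum (fun k => u 0%N k * cpow (iter m (comp_gf q) b) k j).
Proof.
move=> [u0 uS]; elim: m b => // m IH b adb jp.
rewrite iterSr -IH//; last exact: comp_gf_admissible.
have [b0 _] := adb.
transitivity (\sum_(0 <= l <oo)
    nsum (fun k => (u m k * cpow q k l) * cpow b l j)%R)%E.
  apply: eq_eseriesr => l _; rewrite EFinM muleC -uS -nsumZ; last first.
    by move=> k; rewrite mulr_ge0 ?cpow_ge0.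
  by apply: eq_nsum => k; rewrite mulrC.
rewrite nsum_interchange; last first.
  by move=> l k; rewrite !mulr_ge0 ?cpow_ge0.
apply: eq_eseriesr => k _.
rewrite EFinM -(@nsum_cpow_comp _ q b _ p)//; last first.
  by move=> i ip; exact: nsum_comp_gf.
rewrite -nsumZ; last by move=> l; rewrite mulr_ge0 ?cpow_ge0.
by apply: eq_nsum => l; rewrite mulrA.
Qed.

(** For [b = affine_seq s] the left-hand side is the expectation of
    [C(Z, j) * s ^ Z], with [Z] the size of generation [m]. *)
Lemma branching_law_cpow u m b j :
  branching_evolution u -> (forall k, u 0%N k = (k == 1%N)%:R) ->
  admissible b -> (j <= p)%N ->
  nsum (fun k => u m k * cpow b k j) = (iter m (comp_gf q) b j)%:E.
Proof.
move=> ue u01 adb jp; rewrite branching_evolution_cpow//.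
have [a0 _] := iter_comp_gf_admissible m adb.
rewrite (@nsum_delta _ _ 1); first by rewrite u01 mul1r cpow1.
  by move=> k; rewrite u01 mulr_ge0 ?cpow_ge0.
by move=> k /negPf k1; rewrite u01 k1 mul0r.
Qed.

End CriticalIteration.

(** * Asymptotics of the iterates *)

Lemma bernoulli_convex (R : realFieldType) (x : R) k : 0 <= x <= 1 ->
  1 <= x ^+ k + k%:R * (1 - x) /\
  ((1 < k)%N -> 1 + (1 - x) ^+ 2 <= x ^+ k + k%:R * (1 - x)).
Proof.
move=> /andP[x0 x1].
have step l : x ^+ l + l%:R * (1 - x) <= x ^+ l.+1 + l.+1%:R * (1 - x).
  have := exprn_ile1 l x0 x1; rewrite exprS -natr1; nra.
elim: k => [|k [IH1 IH2]]; first by split => //; rewrite expr0 mul0r addr0.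
split; first exact: le_trans (step k).
case: k {IH1} IH2 => [//|[_ _|k IH _]]; first by rewrite !expr2; nra.
exact: le_trans (IH isT) (step _).
Qed.

Section NondegenerateAsymptotics.
Context (R : realType) (q : R^nat) (p : nat).
Context (q_dist : is_offspring_distribution q) (q_crit : critical q)
  (q_mom : has_moment p q) (q1 : q 1%N <> 1).
Let q0 := offspring_ge0 q_dist.
Local Hint Resolve q0 : core.

(** Otherwise the mean 1 of [q] would reduce to [q 1]. *)
Lemma exists_branching : exists2 b, (1 < b)%N & 0 < q b.
Proof.
apply: contra_notP q1 => nb.
have qb b : (1 < b)%N -> q b = 0.
  move=> b1; apply/eqP; rewrite eq_le q0 andbT leNgt; apply/negP => qb.
  by apply: nb; exists b.
have := nsum_offspring_mean q_crit.
rewrite (@nsum_delta _ _ 1%N); first by rewrite mul1r => -[].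
  by move=> k; rewrite mulr_ge0.
by case=> [|[|k]]// _; rewrite ?mul0r// qb// mulr0.
Qed.

(** The generating function of [q] is tangent to the diagonal at 1, by
    criticality, and its convexity is strict, thanks to the term of degree
    [b]. *)
Lemma comp_gf_gap a b : admissible a -> (1 < b)%N ->
  a 0%N + q b * (1 - a 0%N) ^+ 2 <= comp_gf q a 0.
Proof.
move=> ada b1; have [a0 a1] := ada; set x := a 0%N in a1 *.
have x0 : 0 <= x by exact: a0.
pose d k := if k == b then q b * (1 - x) ^+ 2 else 0.
have d0 k : 0 <= d k.
  by rewrite /d; case: ifP => // _; rewrite mulr_ge0// exprn_ge0// subr_ge0.
have c0 k : 0 <= q k * cpow a k 0 by rewrite mulr_ge0 ?cpow_ge0.
have m0 k : 0 <= (1 - x) * (k%:R * q k) by rewrite !mulr_ge0// subr_ge0.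
have : (nsum (fun k => q k + d k)%R <=
        nsum (fun k => q k * cpow a k 0 + (1 - x) * (k%:R * q k))%R)%E.
  apply: le_nsum => k; first by rewrite addr_ge0.
  have x01 : 0 <= x <= 1 by rewrite x0.
  have [H1 H2] := bernoulli_convex k x01.
  rewrite cpow0 -/x /d; have [kb|_] := eqVneq k b.
    rewrite -kb in b1 *; have := ler_wpM2l (q0 k) (H2 b1); nra.
  have := ler_wpM2l (q0 k) H1; nra.
rewrite !nsumD// nsumZ; last by move=> k; rewrite mulr_ge0.
rewrite (nsum_comp_gf q_dist q_mom)// (nsum_offspring q_dist).
rewrite (nsum_offspring_mean q_crit) (@nsum_delta _ d b)//; last first.
  by move=> k /negPf kb; rewrite /d kb.
rewrite /d eqxx -EFinD mule1 -EFinD lee_fin; lra.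
Qed.

(** Almost sure extinction: the iterates increase to a limit, and by
    [comp_gf_gap] a limit below 1 would be exceeded. *)
Lemma iter_comp_gf_cvg1 a : admissible a ->
  (fun m => iter m (comp_gf q) a 0%N) @ \oo --> (1 : R).
Proof.
move=> ada; set t := fun m => _.
have adm m : admissible (iter m (comp_gf q) a).
  exact: (iter_comp_gf_admissible q_dist q_mom).
have [b b1 qb] := exists_branching.
have gap m : t m + q b * (1 - t m) ^+ 2 <= t m.+1 by exact: comp_gf_gap.
have t1 m : t m <= 1 by case: (adm m).
have tcvg : cvgn t.
  apply: nondecreasing_is_cvgn; last first.
    by exists 1 => _ [m _ <-]; exact: t1.
  apply/nondecreasing_seqP => m; apply: le_trans (gap m).
  by rewrite lerDl mulr_ge0// sqr_ge0.
set l := limn t in tcvg.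
have tSl : (fun m => t m.+1) @ \oo --> l by rewrite cvg_shiftS.
have H : (fun m => t m + q b * (1 - t m) ^+ 2) @ \oo --> l + q b * (1 - l) ^+ 2.
  apply: cvgD => //; apply: cvgM; first exact: cvg_cst.
  under eq_fun do rewrite expr2.
  by rewrite expr2; apply: cvgM; apply: cvgB => //; exact: cvg_cst.
have : l + q b * (1 - l) ^+ 2 <= l.
  rewrite -(cvg_lim _ H)// -[leRHS](cvg_lim _ tSl)//; apply: ler_lim.
  - by apply/cvg_ex; exists (l + q b * (1 - l) ^+ 2).
  - by apply/cvg_ex; exists l.
  - exact: nearW.
rewrite gerDl pmulr_rle0// => l1.
have /eqP : (1 - l) ^+ 2 = 0 by apply/eqP; rewrite eq_le l1 sqr_ge0.
by rewrite sqrf_eq0 subr_eq0 => /eqP ->.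
Qed.

Lemma iter_comp_gf_at0 m a : a 0%N = 1 -> iter m (comp_gf q) a 0%N = 1.
Proof.
move=> a1; elim: m => // m IH; rewrite iterS /comp_gf.
under eq_nsum do rewrite cpow0 IH expr1n mulr1.
by rewrite (nsum_offspring q_dist).
Qed.

Lemma iter_comp_gf_at1 m a : a 0%N = 1 -> iter m (comp_gf q) a 1%N = a 1%N.
Proof.
move=> a1; elim: m => // m IH; rewrite iterS /comp_gf.
rewrite (@eq_nsum _ _ (fun k => a 1%N * (k%:R * q k))).
  rewrite nsumZ; last by move=> k; rewrite mulr_ge0.
  by rewrite (nsum_offspring_mean q_crit) mule1.
by move=> k; rewrite cpow_at1 iter_comp_gf_at0// expr1n mulr1 IH; ring.
Qed.

(** The population can carry one more mark after each generation: a first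
    individual with several children gives one mark to one of them, and leaves
    the other marks to another one. *)
Lemma iter_comp_gf_gt0 s m j : 0 < s <= 1 -> (j <= m.+1)%N -> (j <= p)%N ->
  0 < iter m (comp_gf q) (affine_seq s) j.
Proof.
move=> /andP[s0 s1]; have ads : admissible (affine_seq s).
  by apply: affine_seq_admissible; rewrite ltW.
elim: m j => [|m IH] j jm jp; first by rewrite /= /affine_seq jm.
have [b b1 qb] := exists_branching.
have adm : admissible (iter m (comp_gf q) (affine_seq s)).
  exact: (iter_comp_gf_admissible q_dist q_mom).
rewrite iterS; set a := iter m _ _ in adm IH *; have [a0 _] := adm.
rewrite -lte_fin -(nsum_comp_gf q_dist q_mom)//.
apply: lt_le_trans (nsum_ge_term b _); last first.
  by move=> k; rewrite mulr_ge0 ?cpow_ge0.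
rewrite lte_fin mulr_gt0//.
have a0_gt0 : 0 < a 0%N by exact: IH.
case: j jm jp => [|j] jm jp; first by rewrite cpow0 exprn_gt0.
have aj_gt0 : 0 < a j by apply: IH => //; exact: ltnW.
have a1_gt0 : 0 < a 1%N by apply: IH => //; exact: leq_trans jp.
case: b b1 {qb} => [//|b] b0.
have cj : 0 < cpow a b j.
  case: j {jm jp} aj_gt0 => [|j] aj_gt0; first by rewrite cpow0 exprn_gt0.
  by rewrite (lt_le_trans _ (cpow_ge _ a0 _))// !mulr_gt0 ?exprn_gt0 ?ltr0n.
rewrite cpowS 2!big_ord_recl addrA ltr_wpDr//.
  by apply: sumr_ge0 => i _; rewrite mulr_ge0 ?cpow_ge0.
by rewrite ltr_wpDl// ?mulr_ge0 ?cpow_ge0//= subSS subn0 mulr_gt0.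
Qed.

Context (u : nat -> nat -> R) (u_evol : branching_evolution q u)
  (u_start : forall k, u 0%N k = (k == 1%N)%:R).
Context (s : R) (s01 : 0 < s <= 1).

Local Notation A m := (iter m (comp_gf q) (affine_seq s)).

Let u0 m k : 0 <= u m k. Proof. by case: u_evol. Qed.
Local Hint Resolve u0 : core.

Lemma affine_adm : admissible (affine_seq s).
Proof. by apply: affine_seq_admissible; case/andP: s01 => /ltW ->. Qed.

Let A_adm m : admissible (A m).
Proof. exact: (iter_comp_gf_admissible q_dist q_mom _ affine_adm). Qed.

Let A_ge0 m j : 0 <= A m j. Proof. by case: (A_adm m). Qed.
Local Hint Resolve A_ge0 : core.

Lemma nsum_branching_law m : nsum (u m) = 1%E.
Proof.
have ad1 : admissible (affine_seq (1 : R)) by apply: affine_seq_admissible; lra.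
rewrite -[1%E in RHS](_ : (iter m (comp_gf q) (affine_seq 1) 0%N)%:E = 1%E).
  rewrite -(branching_law_cpow q_dist q_mom _ u_evol u_start)//; apply: eq_nsum => k.
  by rewrite cpow0 expr1n mulr1.
by rewrite iter_comp_gf_at0.
Qed.

(** The extinction probability by generation [m] is the [m]-th iterate at 0. *)
Lemma survival_cvg0 : (fun m => 1 - u m 0%N) @ \oo --> (0 : R).
Proof.
have ad0 : admissible (affine_seq (0 : R)) by apply: affine_seq_admissible; lra.
rewrite -[X in _ --> X](subrr (1 : R)); apply: cvgB; first exact: cvg_cst.
rewrite (_ : (fun m => _) = fun m => iter m (comp_gf q) (affine_seq 0) 0%N).
  exact: iter_comp_gf_cvg1.
apply/funext => m; apply: EFin_inj.
rewrite -(branching_law_cpow q_dist q_mom _ u_evol u_start)//.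
rewrite (@nsum_delta _ _ 0).
- by rewrite cpow0 expr0 mulr1.
- by move=> k; rewrite mulr_ge0 ?cpow_ge0//; case: ad0.
- by case=> // k _; rewrite cpow0 expr0n mulr0.
Qed.

(** Both moments are averages, over a common generation, of moments of sums of
    independent copies of the [N]-th generation; the first one is
    linear in the number of copies, the other one at least linear. *)
Lemma moment_ratio_mono N m r : (0 < r <= p)%N ->
  A (m + N) 1%N * A N r <= A (m + N) r * A N 1%N.
Proof.
move=> /andP[r0 rp]; have p0 := leq_trans r0 rp.
have c0 k j : 0 <= u m k * cpow (A N) k j by rewrite mulr_ge0 ?cpow_ge0.
rewrite -lee_fin mulrC [in leRHS]mulrC !EFinM iterD.
rewrite -!(branching_law_cpow q_dist q_mom m u_evol u_start (A_adm N))//.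
rewrite -!nsumZ//; apply: le_nsum => k; first by rewrite mulr_ge0.
rewrite mulrCA [leRHS]mulrCA ler_wpM2l// cpow_at1.
have := ler_wpM2l (A_ge0 N 1) (cpow_ge k (A_ge0 N) r0).
by apply: le_trans; rewrite le_eqVlt; apply/orP; left; apply/eqP; ring.
Qed.

(** The product is a double sum over pairs [(k, l)] of population sizes with
    [k, l > 0], where [k ^ i * l ^ j] is at most [k ^ (i + j) + l ^ (i + j)]: one of
    the two indices carries the whole moment, and the other one contributes the
    survival probability. *)
Lemma moment_product_le m i j : (0 < i)%N -> (0 < j)%N -> (i + j <= p)%N ->
  A m i * A m j <= 2 * (i + j)%:R ^+ (i + j) * (1 - u m 0%N) *
                   (A m 1%N + A m (i + j)%N).
Proof.
move=> i0 j0 ijp; set r := (i + j)%N.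
have r0 : (0 < r)%N by rewrite addn_gt0 i0.
have p0 : (0 < p)%N by exact: leq_trans ijp.
pose g t k := u m k * cpow (affine_seq s) k t.
pose v k := if k == 0%N then 0 else u m k.
pose h k := g 1%N k + g r k.
have s0 : 0 <= s by case/andP: s01 => /ltW.
have g0 t k : 0 <= g t k by rewrite mulr_ge0 ?cpow_ge0//; case: affine_adm.
have v0 k : 0 <= v k by rewrite /v; case: ifP.
have h0 k : 0 <= h k by rewrite addr_ge0.
have gA t : (t <= p)%N -> nsum (g t) = (A m t)%:E.
  by move=> tp; apply: (branching_law_cpow q_dist q_mom) => //; exact: affine_adm.
have hA : nsum h = (A m 1%N + A m r)%:E by rewrite nsumD// !gA.
have vS : nsum v = (1 - u m 0%N)%:E.
  have := nsum_branching_law m.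
  rewrite (_ : nsum (u m) = nsum (fun k => v k + (if k == 0%N then u m k else 0))).
    rewrite nsumD//; last by move=> k; case: ifP.
    rewrite (@nsum_delta _ (fun k => if _ then _ else _) 0)//=; last first.
    - by move=> k /negPf ->.
    - by move=> k; case: ifP.
    case: (nsum v) => // w /eqP; rewrite -EFinD eqe => /eqP <-.
    by congr EFin; ring.
  by apply: eq_nsum => k; rewrite /v; case: ifP; rewrite ?add0r ?addr0.
have key k l : g i k * g j l <= r%:R ^+ r * (v k * h l + h k * v l).
  have binle a b : ('C(a, b)%:R : R) <= a%:R ^+ b.
    have := @cpow_le R (affine_seq 1) 1 a b.
    rewrite cpow_affine expr1n !mul1r; apply => //.
      by move=> c; rewrite /affine_seq; case: ifP.
    by move=> c _; rewrite /affine_seq; case: ifP.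
  have rr0 : 0 <= (r%:R : R) ^+ r by rewrite exprn_ge0.
  have [->|k0] := eqVneq k 0%N.
    rewrite /g cpow_affine bin0n gtn_eqF// !mulr0 mul0r.
    by rewrite mulr_ge0// addr_ge0// mulr_ge0.
  have [->|l0] := eqVneq l 0%N.
    rewrite /g [X in _ * (_ * X) <= _]cpow_affine bin0n gtn_eqF// !mulr0.
    by rewrite mulr_ge0// addr_ge0// mulr_ge0.
  have w0 a : 0 <= u m a * s ^+ a by rewrite mulr_ge0// exprn_ge0.
  have wv a : a != 0%N -> u m a * s ^+ a <= v a.
    move=> /negPf a0; rewrite /v a0 ler_piMr// exprn_ile1//.
    by case/andP: s01.
  have hE a : u m a * s ^+ a * a%:R ^+ r <= r%:R ^+ r * h a.
    rewrite /h /g !cpow_affine bin1.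
    rewrite [X in _ <= _ * X](_ : _ = u m a * s ^+ a * (a%:R + 'C(a, r)%:R)).
      rewrite mulrCA ler_wpM2l// -!natrX -natrD -natrM ler_nat.
      exact: leq_exp_bin.
    ring.
  have gE t a : g t a <= u m a * s ^+ a * a%:R ^+ t.
    by rewrite /g cpow_affine mulrA ler_wpM2l.
  apply: le_trans (ler_pM (g0 _ _) (g0 _ _) (gE _ _) (gE _ _)) _.
  move: (w0 k) (w0 l) (wv k k0) (wv l l0) (hE k) (hE l).
  move: (u m k * s ^+ k) (u m l * s ^+ l) => x y x0 y0 xv yv xh yh.
  have [kl|lk] := leqP k l.
    apply: (@le_trans _ _ (v k * (y * l%:R ^+ r))).
      rewrite (_ : x * _ * _ = x * (y * (k%:R ^+ i * l%:R ^+ j))); last by ring.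
      rewrite ler_pM// ?mulr_ge0 ?exprn_ge0// ler_wpM2l// /r exprD.
      by rewrite ler_wpM2r ?exprn_ge0// lerXn2r ?nnegrE// ler_nat.
    rewrite (_ : _ * (_ + _) = v k * (r%:R ^+ r * h l) + r%:R ^+ r * (h k * v l)).
      by rewrite ler_wpDr ?mulr_ge0// ler_wpM2l.
    by ring.
  apply: (@le_trans _ _ (v l * (x * k%:R ^+ r))).
    rewrite (_ : x * _ * _ = y * (x * (k%:R ^+ i * l%:R ^+ j))); last by ring.
    rewrite ler_pM// ?mulr_ge0 ?exprn_ge0// ler_wpM2l// /r exprD.
    by rewrite ler_wpM2l ?exprn_ge0// lerXn2r ?nnegrE// ler_nat ltnW.
  rewrite (_ : _ * (_ + _) = v l * (r%:R ^+ r * h k) + r%:R ^+ r * (v k * h l)).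
    by rewrite ler_wpDr ?mulr_ge0// ler_wpM2l.
  by ring.
rewrite -lee_fin -(nsum_mul (g0 i) (g0 j)) ?gA//; last 2 first.
- by rewrite (leq_trans _ ijp)// leq_addr.
- by rewrite (leq_trans _ ijp)// leq_addl.
have vh0 k l : 0 <= v k * h l by rewrite mulr_ge0.
have hv0 k l : 0 <= h k * v l by rewrite mulr_ge0.
apply: (@le_trans _ _ (\sum_(0 <= k <oo)
    nsum (fun l => r%:R ^+ r * (v k * h l + h k * v l))%R)%E).
  apply: lee_nneseries => k _; first by move=> _; apply: nsum_ge0 => l; rewrite mulr_ge0.
  by apply: le_nsum => l; [rewrite mulr_ge0|exact: key].
rewrite (_ : (\sum_(0 <= k <oo) _)%E = ((r%:R ^+ r)%:E *
    (\sum_(0 <= k <oo) nsum (fun l => v k * h l)%R +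
     \sum_(0 <= k <oo) nsum (fun l => h k * v l)%R))%E); last first.
  rewrite -nneseriesD; try by move=> *; apply: nsum_ge0 => l.
  rewrite -nneseriesZl; last by move=> *; rewrite adde_ge0//; apply: nsum_ge0 => l.
  apply: eq_eseriesr => k _; rewrite nsumZ; last by move=> l; rewrite addr_ge0.
  by rewrite nsumD.
rewrite (nsum_mul v0 h0 vS hA) (nsum_mul h0 v0 hA vS) -EFinD -EFinM lee_fin.
by rewrite le_eqVlt; apply/orP; left; apply/eqP; ring.
Qed.

Let A_gt0 j : (0 < j <= p)%N -> forall m, 0 < A (m + p) j.
Proof.
move=> /andP[j0 jp] m; apply: iter_comp_gf_gt0 => //.
by rewrite (leq_trans jp)// (leq_trans (leq_addl m p)).
Qed.

(** In the bound of [moment_product_le] the survival probability tends to 0, and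
    [A m 1] is at most a constant times [A m (i + j)]. The constant is read off at
    generation [p], where all the moments of positive order up to [p] are known
    to be positive; hence the shift of the index by [p]. *)
Lemma moment_product_negligible : exists e : nat -> R,
  [/\ e @ \oo --> (0 : R), forall m, 0 <= e m &
  forall m i j, (0 < i)%N -> (0 < j)%N -> (i + j <= p)%N ->
    A (m + p) i * A (m + p) j <= e m * A (m + p) (i + j)%N].
Proof.
pose c r := 2 * r%:R ^+ r * (A p 1%N / A p r + 1).
have c0 r : 0 <= c r by rewrite mulr_ge0 ?addr_ge0 ?divr_ge0// mulr_ge0 ?exprn_ge0.
pose C := \sum_(r < p.+1) c r.
have W0 m : 0 <= 1 - u m 0%N.
  rewrite subr_ge0 -lee_fin.
  rewrite -(nsum_branching_law m).
  exact: nsum_ge_term.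
exists (fun m => C * (1 - u (m + p)%N 0%N)); split.
- rewrite -[X in _ --> X](mulr0 C); apply: cvgM; first exact: cvg_cst.
  rewrite (cvg_shiftn p (fun m => 1 - u m 0%N)).
  exact: survival_cvg0.
- by move=> m; rewrite mulr_ge0// sumr_ge0.
move=> m i j i0 j0 ijp; set r := (i + j)%N.
have r0 : (0 < r <= p)%N by rewrite addn_gt0 i0.
apply: le_trans (moment_product_le (m + p) i0 j0 ijp) _.
have Apr : 0 < A p r by have := A_gt0 r0 0; rewrite add0n.
have A1r : A (m + p) 1%N <= A p 1%N / A p r * A (m + p) r.
  rewrite -mulrA [_^-1 * _]mulrC mulrA ler_pdivlMr// [leRHS]mulrC.
  exact: moment_ratio_mono.
rewrite -/r; apply: (@le_trans _ _ (c r * (1 - u (m + p)%N 0%N) * A (m + p) r)).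
  rewrite [leRHS](_ : _ = 2 * r%:R ^+ r * (1 - u (m + p)%N 0%N) *
      (A p 1%N / A p r * A (m + p) r + A (m + p) r)); last by rewrite /c; ring.
  by rewrite ler_wpM2l ?lerD2r// !mulr_ge0 ?exprn_ge0.
rewrite ler_wpM2r// ler_wpM2r//.
have rp : (r < p.+1)%N by [].
by rewrite /C (bigD1 (Ordinal rp))//= lerDl sumr_ge0.
Qed.

(** The binomial moments of orders 1 and [p] are coefficients of iterates, hence
    finite, and together they control the power moment. *)
Lemma branching_law_moment n : (0 < p)%N ->
  (nsum (fun k => k%:R ^+ p * u n k)%R < +oo)%E.
Proof.
move=> p0; have ad1 : admissible (affine_seq (1 : R)).
  by apply: affine_seq_admissible; lra.
have g0 j k : 0 <= u n k * cpow (affine_seq 1) k j.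
  by rewrite mulr_ge0 ?cpow_ge0//; case: ad1.
apply: (@le_lt_trans _ _ (nsum (fun k => p%:R ^+ p *
    (u n k * cpow (affine_seq 1) k 1 + u n k * cpow (affine_seq 1) k p))%R)).
  apply: le_nsum => k; first by rewrite mulr_ge0// exprn_ge0.
  rewrite !cpow_affine !expr1n !mul1r bin1 -mulrDr mulrCA [leLHS]mulrC.
  by rewrite ler_wpM2l// -!natrX -natrD -natrM ler_nat leq_exp_bin.
rewrite nsumZ; last by move=> k; rewrite addr_ge0.
by rewrite nsumD// !(branching_law_cpow q_dist q_mom n u_evol u_start ad1)//
  -EFinD -EFinM ltry.
Qed.

(** The ratio is squeezed between the contribution of the configurations where
    all the marked individuals descend from the same ancestor, and its limit plus
    a negligible multiple of a moment of order [p]. *)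
Lemma ratio_cvg (n : nat) (v X : nat -> R) (V : R) : (0 < p)%N ->
  (forall k, 0 <= v k <= u n k) ->
  nsum (fun k => k%:R * v k) = V%:E ->
  (forall m, nsum (fun k => v k * cpow (A m) k p) = (X m)%:E) ->
  (fun m => X m / A m p) @ \oo --> V.
Proof.
move=> p0 vu vV vX.
have v0 k : 0 <= v k by case/andP: (vu k).
have pp : (0 < p <= p)%N by rewrite p0 leqnn.
have [e [ecvg e0 He]] := moment_product_negligible.
have vp0 k : 0 <= k%:R ^+ p * v k by rewrite mulr_ge0 ?exprn_ge0.
have [//|vM M0] := @nsum_fin _ _ vp0.
  apply: le_lt_trans (branching_law_moment n p0); apply: le_nsum => k //.
  by rewrite ler_wpM2l ?exprn_ge0//; case/andP: (vu k).
set M := fine _ in vM M0.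
have kv0 k : 0 <= k%:R * v k by rewrite mulr_ge0.
rewrite -(cvg_shiftn p) /=.
pose Y m := fine (nsum (fun k => k%:R * v k * A (m + p) 0%N ^+ k.-1)).
have A01 m : 0 <= A m 0%N <= 1 by rewrite A_ge0; case: (A_adm m) => _ ->.
have yv0 m k : 0 <= k%:R * v k * A (m + p) 0%N ^+ k.-1.
  by rewrite mulr_ge0// exprn_ge0//; case/andP: (A01 (m + p)%N).
have YE m : nsum (fun k => k%:R * v k * A (m + p) 0%N ^+ k.-1) = (Y m)%:E.
  have [|//] := nsum_fin (yv0 m); apply: (@le_lt_trans _ _ V%:E); last exact: ltry.
  rewrite -vV; apply: le_nsum => // k; rewrite ler_piMr// exprn_ile1//.
  by case/andP: (A01 (m + p)%N).
have Ycvg : Y @ \oo --> V.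
  apply: (nsum_cvg_powers kv0 vV (fun m => A01 (m + p)%N) _ YE).
  rewrite (cvg_shiftn p (fun m => A m 0%N)).
  exact: (iter_comp_gf_cvg1 affine_adm).
have c0 m k : 0 <= v k * cpow (A m) k p by rewrite mulr_ge0 ?cpow_ge0.
have lower m : Y m <= X (m + p)%N / A (m + p) p.
  rewrite ler_pdivlMr ?A_gt0// mulrC -lee_fin EFinM -YE -vX -nsumZ//.
  apply: le_nsum => k; first by rewrite mulr_ge0.
  apply: le_trans (ler_wpM2l (v0 k) (cpow_ge k (A_ge0 _) p0)).
  by rewrite le_eqVlt; apply/orP; left; apply/eqP; ring.
have upper m : e m <= 1 -> X (m + p)%N / A (m + p) p <= V + e m * M.
  move=> e1; rewrite ler_pdivrMr ?A_gt0// mulrC -lee_fin -vX EFinM EFinD EFinM.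
  rewrite -vV -vM -nsumZ// -nsumD//; last by move=> k; rewrite mulr_ge0.
  rewrite -nsumZ; last by move=> k; rewrite addr_ge0// mulr_ge0.
  apply: le_nsum => // k.
  have [_ A1] := A_adm (m + p).
  have e01 : 0 <= e m <= 1 by rewrite e0.
  have := ler_wpM2l (v0 k) (cpow_le_eps (A_ge0 _) A1 e01 (He m) k pp).
  move/le_trans; apply.
  by rewrite le_eqVlt; apply/orP; left; apply/eqP; ring.
have Ucvg : (fun m => V + e m * M) @ \oo --> V.
  rewrite -[X in _ --> X]addr0 -(mul0r M).
  by apply: cvgD; [exact: cvg_cst|apply: cvgM => //; exact: cvg_cst].
apply: (squeeze_cvgr _ Ycvg Ucvg).
have : \forall m \near \oo, e m <= 1.
  move/cvgrPdist_le : ecvg => /(_ 1 ltr01); apply: filterS => m.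
  by rewrite sub0r normrN ger0_norm.
by apply: filterS => m /upper ->; rewrite lower.
Qed.

End NondegenerateAsymptotics.

(** Without marks the [k] families contribute the product of their total
    weights, each of which tends to 1. *)
Lemma ratio_cvg0 (R : realType) (q : R^nat) (p : nat) (s : R)
    (v X : nat -> R) (V : R) :
  is_offspring_distribution q -> critical q -> has_moment p q ->
  q 1%N <> 1 -> 0 <= s <= 1 ->
  (forall k, 0 <= v k) -> nsum v = V%:E ->
  (forall m, nsum (fun k => v k * cpow (iter m (comp_gf q) (affine_seq s)) k 0)
    = (X m)%:E) ->
  (fun m => X m / iter m (comp_gf q) (affine_seq s) 0%N) @ \oo --> V.
Proof.
move=> q_dist q_crit q_mom q1 s01 v0 vV vX.
have ads := affine_seq_admissible s01.
have Acvg := iter_comp_gf_cvg1 q_dist q_crit q_mom q1 ads.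
rewrite -[X in _ --> X]divr1; apply: cvgM; last exact: cvgV.
apply: (nsum_cvg_powers (e := id) v0 vV _ Acvg).
  move=> m; have [a0 a1] := iter_comp_gf_admissible q_dist q_mom m ads.
  by rewrite a0.
by move=> m; rewrite -vX; apply: eq_nsum => k; rewrite cpow0.
Qed.

(** * The Markov property of the Galton-Watson process *)

Section IndependentOf.
Context (d : measure_display) (T : measurableType d) (R : realType)
  (P : probability T R) (I : choiceType) (X : I -> {RV P >-> nat}).

Lemma measurable_preimage_nat (Y : {RV P >-> nat}) (B : set nat) :
  measurable (Y @^-1` B).
Proof. exact: measurable_funPTI. Qed.
Local Hint Resolve measurable_preimage_nat : core.

(** The product formula makes [A] independent of the subfamily indexed by [S], and
    contains the mutual independence of that subfamily when [P A] is not 0. This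
    is what allows [A] to absorb events on the [X i] one index at a time. *)
Definition independent_of (S : set I) (A : set T) : Prop :=
  measurable A /\
  forall (J : seq I) (B : I -> set nat), uniq J -> (forall i, i \in J -> S i) ->
    P (A `&` \bigcap_(i in [set` J]) (X i @^-1` B i)) =
    (P A * \prod_(i <- J) P (X i @^-1` B i))%E.

Lemma independent_ofT S : mutually_independent X -> independent_of S setT.
Proof.
move=> indX; split=> // J B uJ _.
by rewrite setTI indX// probability_setT mul1e.
Qed.

Lemma independent_of0 S : independent_of S set0.
Proof. by split=> // J B _ _; rewrite set0I measure0 mul0e. Qed.

Lemma independent_of_sub S S' A : S' `<=` S ->
  independent_of S A -> independent_of S' A.
Proof. by move=> S'S [mA iA]; split=> // J B uJ JS; apply: iA => // i /JS /S'S. Qed.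

Lemma independent_ofI S A i C : independent_of S A -> S i ->
  independent_of (S `\ i) (A `&` X i @^-1` C) /\
  P (A `&` X i @^-1` C) = (P A * P (X i @^-1` C))%E.
Proof.
move=> [mA iA] Si.
have PAC : P (A `&` X i @^-1` C) = (P A * P (X i @^-1` C))%E.
  have := iA [:: i] (fun=> C) isT; rewrite big_seq1 set_cons1 bigcap_set1; apply.
  by move=> j; rewrite inE => /eqP ->.
split=> //; split; first exact: measurableI.
move=> J B uJ JS; pose B' j := if j == i then C else B j.
have iJ : i \notin J by apply/negP => /JS [_]; exact.
have B'J j : j \in J -> B' j = B j.
  by move=> jJ; rewrite /B'; case: eqP jJ iJ => // -> ->.
have := iA (i :: J) B'; rewrite /= iJ uJ => /(_ isT).
rewrite !bigcap_seq !big_cons {1 3}/B' eqxx.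
rewrite (eq_big_seq (fun j => X j @^-1` B j)); last by move=> j /B'J ->.
rewrite (eq_big_seq (fun j => P (X j @^-1` B j))); last by move=> j /B'J ->.
rewrite setIA PAC muleA; apply.
by move=> j; rewrite inE => /orP[/eqP -> //|/JS []].
Qed.

(** Both sides of the product formula are countably additive in the event. *)
Lemma independent_of_bigcup S (F : nat -> set T) : trivIset setT F ->
  (forall k, independent_of S (F k)) -> independent_of S (\bigcup_k F k).
Proof.
move=> tF iF; have mF k : measurable (F k) by case: (iF k).
split; first exact: bigcupT_measurable.
move=> J B uJ JS; rewrite setI_bigcupl.
have mB : measurable (\bigcap_(i in [set` J]) (X i @^-1` B i)).
  by rewrite bigcap_seq; apply: bigsetI_measurable.
have mFB k : measurable (F k `&` \bigcap_(i in [set` J]) (X i @^-1` B i)).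
  exact: measurableI.
rewrite (measure_semi_bigcup _ mFB) ?(measure_semi_bigcup _ mF tF)//; last 3 first.
- exact: bigcupT_measurable.
- exact: trivIset_setIr.
- exact: bigcupT_measurable.
rewrite (eq_bigr (fun i => (fine (P (X i @^-1` B i)))%:E)); last first.
  by move=> i _; rewrite fineK// fin_num_measure.
rewrite prodEFin muleC -nneseriesZl; last by [].
apply: eq_eseriesr => k _; have [_ iFk] := iF k.
apply: etrans (iFk J B uJ JS) _; rewrite muleC -prodEFin; congr (_ * _)%E.
by apply: eq_bigr => i _; rewrite fineK// fin_num_measure.
Qed.

End IndependentOf.
Section GaltonWatson.
Context (d : measure_display) (T : measurableType d) (R : realType)
  (P : probability T R) (q : R^nat) (Z : nat -> {RV P >-> nat})
  (xi : nat -> nat -> {RV P >-> nat}).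
Context (q_ge0 : forall k, 0 <= q k)
  (xi_indep : mutually_independent (fun ki : nat * nat => xi ki.1 ki.2))
  (xi_law : forall k i j, P (xi k i @^-1` [set j]) = (q j)%:E)
  (Z0 : forall w, Z 0%N w = 1%N)
  (ZS : forall k w, Z k.+1 w = (\sum_(i < Z k w) xi k i w)%N).

Local Hint Resolve measurable_preimage_nat : core.

(** The lexicographic order is the one in which the offspring numbers are
    revealed, one individual after the other and one generation after the
    other. *)
Definition future (n i : nat) : set (nat * nat) :=
  [set kl | (n < kl.1)%N \/ kl.1 = n /\ (i <= kl.2)%N].

Local Notation indep := (independent_of (fun ki : nat * nat => xi ki.1 ki.2)).

(** Revealing one more offspring number convolves the law of the partial sum with
    [q], and the enlarged event stays independent of what is still hidden. *)
Lemma independent_offspring_sum n k j A : indep (future n 0) A ->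
  indep (future n k) (A `&` [set w | (\sum_(i < k) xi n i w)%N = j]) /\
  P (A `&` [set w | (\sum_(i < k) xi n i w)%N = j]) = (P A * (cpow q k j)%:E)%E.
Proof.
move=> iA; elim: k j => [|k IH] j.
  case: j => [|j].
    rewrite (_ : [set w | _] = setT) ?setIT ?mule1//.
    by apply/seteqP; split => // w _ /=; rewrite big_ord0.
  rewrite (_ : [set w | _] = set0); last first.
    by apply/seteqP; split => // w /=; rewrite big_ord0.
  by rewrite setI0 measure0 mule0; split => //; exact: independent_of0.
pose G x := A `&` [set w | (\sum_(i < k) xi n i w)%N = (j - x)%N].
pose F x := if (x <= j)%N then G x `&` xi n k @^-1` [set x] else set0.
have iG x : indep (future n k.+1) (G x `&` xi n k @^-1` [set x]) /\
    P (G x `&` xi n k @^-1` [set x]) = (P (G x) * (q x)%:E)%E.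
  have [iGx _] := IH (j - x)%N.
  have nk : future n k (n, k) by right.
  have [iGx' PGx] := independent_ofI [set x] iGx nk.
  rewrite -(xi_law n k x); split => //; apply: independent_of_sub iGx' => -[a b] /= h.
  split; first by case: h => /= [|[-> /ltnW]]; [left|right].
  by case: h => /= [na [an _]|[_ kb] [_ bk]]; [rewrite an ltnn in na|rewrite bk ltnn in kb].
have -> : A `&` [set w | (\sum_(i < k.+1) xi n i w)%N = j] = \bigcup_x F x.
  apply/seteqP; split=> [w [Aw /=]|w [x _]].
    rewrite big_ord_recr/= => wj; exists (xi n k w) => //.
    by rewrite /F -wj leq_addl; split => //; split => //=; rewrite -wj addnK.
  rewrite /F; case: ifP => // xj [[Aw /= wj] /= wx]; split => //=.
  by rewrite big_ord_recr/= wj wx subnK.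
have tF : trivIset setT F.
  move=> x y _ _ [w []]; rewrite /F; case: ifP => // _ [_ /= <-].
  by case: ifP => // _ [_ /= ->].
have iF x : indep (future n k.+1) (F x).
  by rewrite /F; case: ifP => _; [case: (iG x)|exact: independent_of0].
have iU := independent_of_bigcup tF iF; split => //.
have mF x : measurable (F x) by case: (iF x).
rewrite (measure_semi_bigcup _ mF tF (proj1 iU)) (nneseries_split 0 j.+1)//.
rewrite add0n [X in (_ + X)%E]eseries0 ?adde0; last first.
  by move=> x jx _; rewrite /F leqNgt jx measure0.
rewrite big_mkord cpowS -sumEFin ge0_sume_distrr; last first.
  by move=> i _; rewrite lee_fin mulr_ge0 ?cpow_ge0.
apply: eq_bigr => x _; rewrite /F -ltnS ltn_ord.
have [_ PGx] := iG x; apply: etrans PGx _.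
have [_ ->] := IH (j - x)%N.
by rewrite -muleA -EFinM mulrC.
Qed.

(** The event is cut along the size of generation [n], which tells how many
    offspring numbers make up generation [n + 1]. *)
Definition past_event n (A : set T) : Prop :=
  forall k, indep (future n 0) (A `&` Z n @^-1` [set k]).

(** On the slice where generation [n] has size [j], generation [n + 1] is a sum of
    [j] offspring numbers independent of the slice. *)
Lemma markov_step n A k : past_event n A ->
  indep (future n.+1 0) (A `&` Z n.+1 @^-1` [set k]) /\
  P (A `&` Z n.+1 @^-1` [set k]) =
  (\sum_(0 <= j <oo) P (A `&` Z n @^-1` [set j]) * (cpow q j k)%:E)%E.
Proof.
move=> iA.
pose F j := (A `&` Z n @^-1` [set j]) `&` [set w | (\sum_(i < j) xi n i w)%N = k].
have FE : A `&` Z n.+1 @^-1` [set k] = \bigcup_j F j.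
  apply/seteqP; split=> [w [Aw /= wk]|w [j _ [[Aw /= <-] /= wk]]].
    by exists (Z n w) => //; split => //=; rewrite -ZS.
  by split => //=; rewrite ZS.
have tF : trivIset setT F by move=> x y _ _ [w [[[_ /= <-] _] [[_ /= <-] _]]].
have iF j : indep (future n.+1 0) (F j).
  have [iFj _] := independent_offspring_sum j k (iA j).
  by apply: independent_of_sub iFj => -[a b] [/= na|[/= -> _]]; left => //; exact: ltnW.
have iU := independent_of_bigcup tF iF; rewrite FE; split => //.
have mF x : measurable (F x) by case: (iF x).
rewrite (measure_semi_bigcup _ mF tF (proj1 iU)); apply: eq_eseriesr => j _.
by have [_ PF] := independent_offspring_sum j k (iA j); exact: PF.
Qed.

Lemma past_eventD n m A : past_event n A -> past_event (n + m) A.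
Proof.
move=> iA; elim: m => [|m IH]; first by rewrite addn0.
by rewrite addnS => k; have [] := markov_step k IH.
Qed.

Lemma past_eventT : past_event 0 setT.
Proof.
move=> k; have [->|k1] := eqVneq k 1%N.
  rewrite (_ : _ `&` _ = setT); first exact: independent_ofT.
  by apply/seteqP; split => // w _; split => //=; exact: Z0.
rewrite (_ : _ `&` _ = set0); first exact: independent_of0.
by apply/seteqP; split => // w [_ /= wk]; move: k1; rewrite -wk Z0 eqxx.
Qed.

(** Induction on [n]: once [Z n.+1] is fixed to [k], only [Z 0], ..., [Z n] remain
    free, so the slice of [A] is also the slice of a set determined by these, and
    [markov_step] applies. *)
Lemma determined_past_event n A :
  (forall w w', (forall k, (k <= n)%N -> Z k w = Z k w') -> A w -> A w') ->
  past_event n A.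
Proof.
elim: n A => [|n IH] A dA k.
  have [[w Aw]|nA] := pselect (exists w, A w).
    rewrite (_ : A = setT); first exact: past_eventT.
    apply/seteqP; split => // w' _; apply: dA Aw => j.
    by rewrite leqn0 => /eqP ->; rewrite !Z0.
  rewrite (_ : _ `&` _ = set0); first exact: independent_of0.
  by apply/seteqP; split => // w [Aw _]; apply: nA; exists w.
pose B := [set w | exists w', [/\ forall j, (j <= n)%N -> Z j w = Z j w',
                                 Z n.+1 w' = k & A w']].
have -> : A `&` Z n.+1 @^-1` [set k] = B `&` Z n.+1 @^-1` [set k].
  apply/seteqP; split=> w [Aw /= wk]; split => //; first by exists w.
  case: Aw => w' [ww' w'k Aw']; apply: dA Aw' => j.
  by rewrite leq_eqVlt => /predU1P[->|/ww' ->//]; rewrite wk w'k.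
have iB : past_event n B.
  apply: IH => w w' ww' [w'' [h1 h2 h3]]; exists w''; split => // j jn.
  by rewrite -ww'// h1.
by have [] := markov_step k iB.
Qed.

(** The sets determined by the values of [Z 0], ..., [Z n] form a sigma-algebra
    that contains the generators of the filtration. *)
Lemma filtration_past_event n L : natural_filtration Z n L -> past_event n L.
Proof.
move=> LF; apply: determined_past_event.
pose D := [set A : set T | forall w w',
  (forall k, (k <= n)%N -> Z k w = Z k w') -> A w -> A w'].
suff : natural_filtration Z n `<=` D by apply.
apply: smallest_sub.
  split=> [w w' _ []|A DA|F DF] /=.
    move=> w w' ww' [_ nAw]; split => // Aw'; apply: nAw.
    by apply: DA Aw' => k kn; rewrite ww'.
  by move=> w w' ww' [j _ Fw]; exists j => //; exact: DF ww' Fw.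
rewrite -bigcup_mkord_ord => A [i /= ni [B _ <-]] w w' ww' [_ /= Bw].
by split => //=; rewrite -ww'// leq_ord.
Qed.

Definition slice_mass n (L : set T) m k : R :=
  fine (P (L `&` Z (n + m) @^-1` [set k])).

Lemma slice_massE n L m k : past_event n L ->
  P (L `&` Z (n + m) @^-1` [set k]) = (slice_mass n L m k)%:E.
Proof.
move=> iL; rewrite /slice_mass fineK// fin_num_measure//.
by case: (past_eventD m iL k).
Qed.

Lemma slice_mass_ge0 n L m k : 0 <= slice_mass n L m k.
Proof. exact: fine_ge0. Qed.

Lemma slice_mass_evolution n L : past_event n L ->
  branching_evolution q (slice_mass n L).
Proof.
move=> iL; split=> [m k|m j]; first exact: slice_mass_ge0.
rewrite -slice_massE// addnS.
have [_ ->] := markov_step j (past_eventD m iL).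
by apply: eq_eseriesr => k _; rewrite slice_massE.
Qed.

Lemma slice_mass_start k : slice_mass 0 setT 0 k = (k == 1%N)%:R.
Proof.
rewrite /slice_mass setTI; have [->|k1] := eqVneq k 1%N.
  rewrite (_ : _ @^-1` _ = setT); first by rewrite probability_setT.
  by apply/seteqP; split => // w _; exact: Z0.
rewrite (_ : _ @^-1` _ = set0); first by rewrite measure0.
by apply/seteqP; split => // w /= wk; move: k1; rewrite -wk Z0 eqxx.
Qed.

Lemma slice_mass_le n L m k : past_event n L ->
  slice_mass n L m k <= slice_mass 0 setT (n + m) k.
Proof.
move=> iL; rewrite -lee_fin -!slice_massE//; last exact: past_eventT.
apply: le_measure; rewrite ?inE//; last by rewrite setTI; exact: subIsetr.
- by case: (past_eventD m iL k).
- exact: measurableI.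
Qed.

Lemma expectation_slices n L m (g : nat -> R) : past_event n L ->
  (forall k, 0 <= g k) ->
  ('E_P[fun w => (g (Z (n + m)%N w) * \1_L w)%R])%E =
  nsum (fun k => slice_mass n L m k * g k).
Proof.
move=> iL g0; rewrite unlock.
pose S k := L `&` Z (n + m) @^-1` [set k].
have mS k : measurable (S k) by case: (past_eventD m iL k).
transitivity (\int[P]_w (\sum_(0 <= k <oo) (g k)%:E * (\1_(S k) w)%:E))%E.
  apply: eq_integral => w _; apply/esym.
  transitivity (nsum (fun k => g k * \1_(S k) w)); first exact: eq_eseriesr.
  rewrite (@nsum_delta _ _ (Z (n + m)%N w)).
  - congr (_ * _)%:E; rewrite !indicE; congr (_%:R); congr nat_of_bool.
    by apply/idP/idP; rewrite !inE; [case|split].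
  - by move=> k; rewrite mulr_ge0.
  - move=> k kZ; rewrite indicE memNset ?mulr0// => -[_ /= wk].
    by rewrite wk eqxx in kZ.
rewrite integral_nneseries//; last 2 first.
- move=> k; apply: measurable_funeM; apply/measurable_EFinP.
  exact: measurable_indic.
- by move=> k w _; rewrite -EFinM lee_fin mulr_ge0.
apply: eq_eseriesr => k _.
rewrite ge0_integralZl_EFin//; last by apply/measurable_EFinP; exact: measurable_indic.
rewrite integral_indic// setIT EFinM muleC; congr (_ * _)%E.
exact: slice_massE.
Qed.

End GaltonWatson.
(** * Ratio of moments *)

Lemma horner_hilbert_poly (R : realType) p k :
  (hilbert_poly R p).[k%:R] = 'C(k, p)%:R.
Proof.
rewrite /hilbert_poly hornerZ horner_prod.
rewrite (eq_bigr (fun i : 'I_p => k%:R - i%:R)); last first.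
  by move=> i _; rewrite !hornerE.
suff -> : \prod_(i < p) (k%:R - i%:R) = (k ^_ p)%:R :> R.
  by rewrite -bin_ffact natrM mulrC mulfK// pnatr_eq0 gtn_eqF// fact_gt0.
elim: p => [|p IH]; first by rewrite big_ord0.
rewrite big_ord_recr/= IH ffactnSr natrM.
have [pk|kp] := leqP p k; first by rewrite natrB.
by rewrite ffact_small// !mul0r.
Qed.

(** When everybody has exactly one child the iterates are constant and the
    population stays at 1; otherwise the limits above apply. *)
Lemma ratio_cvg_all (R : realType) (q : R^nat) (p n : nat) (s : R)
    (u : nat -> nat -> R) (v X : nat -> R) (V : R) :
  is_offspring_distribution q -> critical q -> has_moment p q ->
  0 <= s <= 1 -> (p = 0%N \/ 0 < s) -> (q 1%N = 1 -> (p <= 1)%N /\ 0 < s) ->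
  branching_evolution q u -> (forall k, u 0%N k = (k == 1%N)%:R) ->
  (forall k, 0 <= v k <= u n k) ->
  nsum (fun k => k%:R ^+ (0 < p)%N * v k) = V%:E ->
  (forall m, nsum (fun k => v k * cpow (iter m (comp_gf q) (affine_seq s)) k p)
    = (X m)%:E) ->
  (fun m => X m / iter m (comp_gf q) (affine_seq s) p) @ \oo --> V.
Proof.
move=> q_dist q_crit q_mom s01 hps hqps ue u01 vu vV vX.
have v0 k : 0 <= v k by case/andP: (vu k).
have [q1|q1] := eqVneq (q 1%N) 1; last first.
  move/eqP in q1; have [p0|p0] := posnP p.
    subst p; have vV' : nsum v = V%:E.
      by rewrite -vV; apply: eq_nsum => k; rewrite mul1r.
    exact: (ratio_cvg0 q_dist q_crit q_mom q1 s01 v0 vV' vX).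
  case: hps => [p0'|s0]; first by rewrite p0' in p0.
  have s01' : 0 < s <= 1 by rewrite s0; case/andP: s01.
  have vV' : nsum (fun k => k%:R * v k) = V%:E.
    by rewrite -vV; apply: eq_nsum => k; rewrite p0 expr1.
  exact: (ratio_cvg q_dist q_crit q_mom q1 ue u01 s01' p0 vu vV' vX).
have [p1 s0] := hqps q1; have q0 := offspring_ge0 q_dist.
have qE k : q k = (k == 1%N)%:R.
  have [->//|k1] := eqVneq k 1%N; apply/eqP; rewrite eq_le q0 andbT.
  pose a l := if l == 1%N then q l else 0.
  pose b l := if l == k then q l else 0.
  have a0 l : 0 <= a l by rewrite /a; case: ifP.
  have b0 l : 0 <= b l by rewrite /b; case: ifP.
  have : (nsum (fun l => a l + b l)%R <= nsum q)%E.
    apply: le_nsum => l; first by rewrite addr_ge0.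
    rewrite /a /b; have [->|_] := eqVneq l 1%N; last by rewrite add0r; case: ifP.
    by rewrite eq_sym (negPf k1) addr0.
  rewrite nsumD// (@nsum_delta _ a 1%N)//; last by move=> l /negPf; rewrite /a => ->.
  rewrite (@nsum_delta _ b k)//; last by move=> l /negPf; rewrite /b => ->.
  by rewrite (nsum_offspring q_dist) /a /b !eqxx q1 -EFinD lee_fin gerDl.
have comp_id b : (forall j, 0 <= b j) -> comp_gf q b =1 b.
  move=> b0 j; rewrite /comp_gf (@nsum_delta _ _ 1%N) ?qE ?mul1r ?cpow1//.
    by move=> k; rewrite mulr_ge0 ?cpow_ge0.
  by move=> k /negPf k1; rewrite qE k1 mul0r.
have AE m : iter m (comp_gf q) (affine_seq s) = affine_seq s.
  have [ads _] := affine_seq_admissible s01.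
  by elim: m => //= m ->; apply/funext => j; exact: comp_id.
have uE m k : u m k = (k == 1%N)%:R.
  elim: m k => // m IH k; apply: EFin_inj; rewrite -(proj2 ue).
  rewrite (@nsum_delta _ _ 1%N) ?IH ?mul1r ?cpow1 ?qE//.
    by move=> l; rewrite mulr_ge0 ?cpow_ge0//; case: ue.
  by move=> l /negPf l1; rewrite IH l1 mul0r.
have vE k : k != 1%N -> v k = 0.
  by move=> /negPf k1; have := vu k; rewrite uE k1 => /le_anti.
have VE : V = v 1%N.
  apply: EFin_inj; rewrite -vV (@nsum_delta _ _ 1%N) ?expr1n ?mul1r//.
    by move=> k; rewrite mulr_ge0 ?exprn_ge0.
  by move=> k /vE ->; rewrite mulr0.
have XE m : X m = v 1%N * s.
  apply: EFin_inj; rewrite -vX AE (@nsum_delta _ _ 1%N).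
  - by rewrite cpow1 /affine_seq p1.
  - move=> k; rewrite mulr_ge0 ?cpow_ge0//.
    by case: (affine_seq_admissible s01).
  - by move=> k /vE ->; rewrite mul0r.
rewrite (_ : (fun m => _) = fun=> V); first exact: cvg_cst.
apply/funext => m; rewrite XE AE /affine_seq p1 VE mulfK//.
by rewrite gt_eqF.
Qed.

(* The last two hypotheses on (p, s, q) exclude exactly the cases where the
   denominator vanishes for all large m, i.e. where the ratio is undefined:
   s = 0 with p >= 1; and, for the Dirac mass q at 1, p >= 2 or s = 0. *)
Theorem theorem3p8 (d : measure_display) (T : measurableType d) (R : realType)
    (P : probability T R) (q : R^nat) (Z : nat -> {RV P >-> nat}) (p : nat)
    (hq : is_offspring_distribution q) (hcrit : critical q)
    (hmom : has_moment p q) (hZ : is_galton_watson q Z)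
    (s : R) (hs : 0 <= s <= 1)
    (hps : p = 0%N \/ 0 < s)
    (hqps : q 1%N = 1 -> (p <= 1)%N /\ 0 < s)
    (n : nat) (L : set T) (hL : natural_filtration Z n L) :
  (fun m : nat =>
     fine 'E_P[fun w => (hilbert_poly R p).[(Z (m + n)%N w)%:R]
                        * s ^+ Z (m + n)%N w * \1_L w]
     / fine 'E_P[fun w => (hilbert_poly R p).[(Z (m + n)%N w)%:R]
                          * s ^+ Z (m + n)%N w])
  @ \oo -->
  (if p == 0%N then fine 'E_P[\1_L : T -> R]
   else fine 'E_P[fun w => (Z n w)%:R * \1_L w]).
Proof.
case: hZ => xi [xi_indep xi_law Z0 ZS].
have q0 := offspring_ge0 hq.
have pastL := filtration_past_event q0 xi_indep xi_law Z0 ZS hL.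
have pastT := past_eventT xi_indep Z0.
(* Slicing the sure event from generation 0 on gives the laws [u m] of the
   generations; slicing [L] at generation [n] gives the weights of the sum. *)
pose u := slice_mass Z 0 setT; pose v := slice_mass Z n L 0.
have u_evol : branching_evolution q u.
  exact: (slice_mass_evolution q0 xi_law ZS pastT).
have u_start k : u 0%N k = (k == 1%N)%:R by exact: slice_mass_start.
have v0 k : 0 <= v k by exact: slice_mass_ge0.
have vu k : 0 <= v k <= u n k.
  rewrite v0 -[n in u n]addn0.
  exact: (slice_mass_le q0 xi_indep xi_law Z0 ZS).
pose A m := iter m (comp_gf q) (affine_seq s).
have ads := affine_seq_admissible hs.
have A0 m j : 0 <= A m j.
  by case: (iter_comp_gf_admissible hq hmom m ads) => + _; apply.
have Au m : nsum (fun k => u n k * cpow (A m) k p) = (A (m + n)%N p)%:E.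
  rewrite (branching_law_cpow hq hmom n u_evol u_start)//.
    by rewrite /A addnC iterD.
  exact: (iter_comp_gf_admissible hq hmom m ads).
have vA0 m k : 0 <= v k * cpow (A m) k p by rewrite mulr_ge0 ?cpow_ge0.
pose X m := fine (nsum (fun k => v k * cpow (A m) k p)).
have XE m : nsum (fun k => v k * cpow (A m) k p) = (X m)%:E.
  have [|//] := nsum_fin (vA0 m).
  apply: (@le_lt_trans _ _ (A (m + n)%N p)%:E); last exact: ltry.
  rewrite -Au; apply: le_nsum => // k; rewrite ler_wpM2r ?cpow_ge0//.
  by case/andP: (vu k).
have u1 : nsum (fun k => k%:R ^+ (0 < p)%N * u n k) = 1%E.
  have ad1 : admissible (affine_seq (1 : R)) by apply: affine_seq_admissible; lra.
  transitivity (nsum (fun k => u n k * cpow (affine_seq 1) k (0 < p)%N)).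
    apply: eq_nsum => k; rewrite cpow_affine expr1n mul1r mulrC.
    by case: (0 < p)%N; rewrite ?bin1 ?bin0.
  rewrite (branching_law_cpow hq hmom n u_evol u_start)//; last by case: (p).
  case: (0 < p)%N => /=.
    by rewrite (iter_comp_gf_at1 hq hcrit).
  by rewrite (iter_comp_gf_at0 hq).
have kv0 k : 0 <= k%:R ^+ (0 < p)%N * v k by rewrite mulr_ge0 ?exprn_ge0.
pose V := fine (nsum (fun k => k%:R ^+ (0 < p)%N * v k)).
have VE : nsum (fun k => k%:R ^+ (0 < p)%N * v k) = V%:E.
  have [|//] := nsum_fin kv0.
  apply: (@le_lt_trans _ _ 1%E); last exact: ltry.
  rewrite -u1; apply: le_nsum => // k; rewrite ler_wpM2l ?exprn_ge0//.
  by case/andP: (vu k).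
have limL := ratio_cvg_all hq hcrit hmom hs hps hqps u_evol u_start vu VE XE.
have limT : (fun m => A (m + n)%N p / A m p) @ \oo --> (1 : R).
  have uu k : 0 <= u n k <= u n k by rewrite lexx andbT; case: u_evol.
  exact: (ratio_cvg_all hq hcrit hmom hs hps hqps u_evol u_start uu u1 Au).
have gE k : (hilbert_poly R p).[k%:R] * s ^+ k = cpow (affine_seq s) k p.
  by rewrite horner_hilbert_poly cpow_affine mulrC.
have EL m : ('E_P[fun w => ((hilbert_poly R p).[(Z (m + n)%N w)%:R]
    * s ^+ Z (m + n)%N w * \1_L w)%R] = (X m)%:E)%E.
  under eq_fun do rewrite gE addnC.
  rewrite (expectation_slices q0 xi_law ZS m pastL
    (g := fun k => cpow (affine_seq s) k p)); last first.
    by move=> k; rewrite cpow_ge0//; case: ads.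
  rewrite -XE (branching_evolution_cpow hq hmom)//.
  exact: (slice_mass_evolution q0 xi_law ZS pastL).
have ET m : ('E_P[fun w => ((hilbert_poly R p).[(Z (m + n)%N w)%:R]
    * s ^+ Z (m + n)%N w)%R] = (A (m + n)%N p)%:E)%E.
  rewrite -(branching_law_cpow hq hmom (m + n) u_evol u_start ads)//.
  rewrite -(expectation_slices q0 xi_law ZS (m + n) pastT
    (g := fun k => cpow (affine_seq s) k p)).
    by congr ('E_P[_])%E; apply/funext => w; rewrite gE indicT mulr1.
  by move=> k; rewrite cpow_ge0//; case: ads.
have -> : (if p == 0%N then fine 'E_P[\1_L : T -> R]
   else fine 'E_P[fun w => (Z n w)%:R * \1_L w]) = V.
  transitivity (fine 'E_P[fun w => (Z n w)%:R ^+ (0 < p)%N * \1_L w]).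
    have [_|//] := posnP p.
    by congr (fine 'E_P[_]); apply/funext => w; rewrite mul1r.
  rewrite -[n in Z n]addn0.
  rewrite (expectation_slices q0 xi_law ZS 0 pastL (g := fun k => k%:R ^+ (0 < p)%N)).
    by congr fine; apply: eq_nsum => k; rewrite mulrC.
  by move=> k; rewrite exprn_ge0.
under eq_fun do rewrite EL ET.
(* The two known limits are those of the numerator and of the denominator over
   the weight [A m p] of one family, which cancels out once it is nonzero. *)
rewrite -[V]divr1.
have lim : (fun m => (X m / A m p) / (A (m + n)%N p / A m p)) @ \oo --> V / 1.
  by apply: cvgM => //; apply: cvgV.
apply: cvg_trans lim; apply: near_eq_cvg.
have : \forall m \near \oo, A (m + n)%N p / A m p != 0.
  move/cvgrPdist_lt : limT => /(_ 1 ltr01); apply: filterS => m.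
  by apply: contraTneq => ->; rewrite subr0 normr1 ltxx.
apply: filterS => m; have [->|Am _] := eqVneq (A m p) 0.
  by rewrite invr0 mulr0 eqxx.
by rewrite /= invfM invrK mulrACA mulVf// mulr1.
Qed.
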